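(* Suppose a strongly regular graph $\Delta$ with parameters $(352,26,0,2)$ exists, and let $x\in\operatorname{Aut}(\Delta)$ have prime order $p\in\{11,13\}$. \begin{enumerate} \item[(1)] If $p=13$, then $\operatorname{Fix}(x)\cong K_1$ and $a_1(x)=26$. \item[(2)] If $p=11$, then $\operatorname{Fix}(x)=\varnothing$ and $a_1(x^i)=22$ for $i=1,\dots,10$. \end{enumerate}
   Context: A strongly regular graph with parameters $(v,k,\lambda,\mu)$ is a finite simple $k$-regular graph on $v$ vertices in which any two adjacent vertices have exactly $\lambda$ common neighbours and any two distinct non-adjacent vertices have exactly $\mu$ common neighbours. For an automorphism $g$ of $\Delta$, $\operatorname{Fix}(g)$ is the subgraph induced on the vertices fixed by $g$ (with $\operatorname{Fix}(g)=\varnothing$ meaning that $g$ fixes no vertex), and $a_1(g)=|\{u\in V(\Delta):u\sim g(u)\}|$ is the number of vertices adjacent to their image under $g$. $K_1$ is the one-vertex graph. *)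

(* Defs.v *)
From mathcomp Require Import all_boot all_fingroup.

Set Implicit Arguments.
Unset Strict Implicit.
Unset Printing Implicit Defensive.

Local Open Scope group_scope.

Record sgraph := SGraph {
  vertex :> finType;
  adj : rel vertex;
  adj_sym : symmetric adj;
  adj_irrefl : irreflexive adj }.

Definition neighbours (G : sgraph) (u : G) : {set G} := [set w | adj u w].

Definition strongly_regular (G : sgraph) (v k lambda mu : nat) : Prop :=
  [/\ #|G| = v,
      forall u : G, #|neighbours u| = k,
      forall u w : G, adj u w ->
        #|neighbours u :&: neighbours w| = lambda
    & forall u w : G, u != w -> ~~ adj u w ->
        #|neighbours u :&: neighbours w| = mu].

Definition graph_iso (G H : sgraph) : Prop :=
  exists2 f : G -> H, bijective f & forall u w, adj (f u) (f w) = adj u w.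

Section Induced.
Variables (G : sgraph) (A : {set G}).

Definition induced_adj : rel {u : G | u \in A} :=
  [rel u w | adj (val u) (val w)].

Lemma induced_adj_sym : symmetric induced_adj.
Proof. by move=> u w; exact: adj_sym. Qed.

Lemma induced_adj_irrefl : irreflexive induced_adj.
Proof. by move=> u; exact: adj_irrefl. Qed.

Definition induced : sgraph := SGraph induced_adj_sym induced_adj_irrefl.

End Induced.

Section Complete.
Variable n : nat.

Lemma complete_sym : symmetric [rel i j : 'I_n | i != j].
Proof. by move=> i j; rewrite /= eq_sym. Qed.

Lemma complete_irrefl : irreflexive [rel i j : 'I_n | i != j].
Proof. by move=> i; rewrite /= eqxx. Qed.

Definition complete_graph : sgraph := SGraph complete_sym complete_irrefl.

End Complete.

Definition graph_aut (G : sgraph) : {set {perm G}} :=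
  [set g : {perm G} | [forall u, forall w, adj (g u) (g w) == adj u w]].

Lemma graph_aut_group_set (G : sgraph) : group_set (graph_aut G).
Proof.
apply/group_setP; split.
  by rewrite inE; apply/forallP=> u; apply/forallP=> w; rewrite !perm1.
move=> g h; rewrite !inE => /forallP gA /forallP hA.
apply/forallP=> u; apply/forallP=> w; rewrite !permM.
by rewrite (eqP (forallP (hA _) _)) (eqP (forallP (gA _) _)).
Qed.

Canonical graph_aut_group (G : sgraph) : {group {perm G}} :=
  Group (graph_aut_group_set G).

Definition fixed_graph (G : sgraph) (g : {perm G}) : sgraph :=
  induced 'Fix_'P[g].

Definition a1 (G : sgraph) (g : {perm G}) : nat :=
  #|[set u : G | adj u (g u)]|.

(* Main.v *)
Require Import Defs.
From mathcomp Require Import all_boot all_algebra.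
From mathcomp Require Import all_fingroup all_solvable all_field.
From mathcomp Require Import ring zify.

Set Implicit Arguments.
Unset Strict Implicit.
Unset Printing Implicit Defensive.

Import GRing.Theory Num.Theory.

(** The adjacency matrix [A] of the graph has the eigenvalues 26, 4 and -6 with
multiplicities 1, 208 and 143. An automorphism [x] acts on the 143-dimensional
eigenspace of -6, and computing its trace there with the explicit spectral
projector [eigenproj] gives [(4 * a0 x - a1 x + 22) / 10], where [a0] counts
fixed vertices. That number is rational; as the eigenvalues of [x] are [p]-th
roots of unity, Galois conjugacy makes all primitive [p]-th roots occur equally
often, say [n1] times, so that [143 = n0 + (p - 1) * n1] and every nontrivial
power of [x] has trace [n0 - n1] ([mxtrace_prime_order],
[srg_prime_aut_trace]). Once [a0] is known, only a few values of [a1] remain,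
and [a1] is the same for all nontrivial powers of [x].

The fixed vertices are found by elementary counting. Two common neighbours of
two nonadjacent fixed vertices cannot be moved by an automorphism of odd prime
order, so a moved vertex has at most one fixed neighbour. Hence, if each fixed
vertex has [d > 0] fixed neighbours, there are at least [2 * d] fixed vertices,
each with its private set of [26 - d] moved neighbours; this gives
[2 * d * (27 - d) <= 352] ([fixed_regular_bound]), which fails for [d = 13] and
[d = 15]. Modulo [p] the number of fixed neighbours of a fixed vertex is 0 for
[p = 13] and 4 for [p = 11], and it is less than 26. So for [p = 13] there is
one fixed vertex. For [p = 11] a fixed vertex with exactly 4 fixed neighbours
leads to a local contradiction ([no_fixed_degree4]), and nothing is fixed.

For [p = 13] the trace equation then gives [a1 x = 26]. For [p = 11] it leaves
22 and 132. Each orbit of [x] has 11 vertices and induces a circulant graph,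
without triangles and with at most two common neighbours for a pair of
vertices; such a graph has degree at most 2 ([circulant11]). So the sum of
[a1 (x ^+ i)] over [0 < i < 11] is at most [2 * 352], less than [10 * 132]. *)

(** * Traces of matrices of prime order *)

Section Traces.

Local Open Scope ring_scope.

Lemma mxtrace_idem (F : fieldType) n (E : 'M[F]_n) :
  E *m E = E -> \tr E = (\rank E)%:R.
Proof.
move=> idE; move: (mulmx_base E) (row_base_free E) (col_base_full E).
move: (row_base E) (col_base E) => R L defE freeR fullL.
rewrite -{1}defE mxtrace_mulC.
suff -> : R *m L = 1%:M by rewrite mxtrace1.
apply: (row_free_inj freeR); rewrite /= mul1mx.
apply: (row_full_inj fullL) => /=.
by rewrite -mulmxA mulmxA defE idE.
Qed.

(** The averaging operator over the powers of [w P] is the projector on an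
eigenspace of [P]; composed with [E] it is again idempotent, so its trace is a
rank. *)
Lemma average_trace_nat (R : numFieldType) p n (P E : 'M[R]_n.+1) (w : R) :
    (0 < p)%N -> P ^+ p = 1 -> P * E = E * P -> E * E = E -> w ^+ p = 1 ->
  exists m : nat, \sum_(i < p) w ^+ i * \tr (P ^+ i * E) = (p * m)%:R.
Proof.
move=> p_gt0 Pp PE idE wp; have p_neq0 : p%:R != 0 :> R by rewrite pnatr_eq0 -lt0n.
pose Q := w *: P; pose S := \sum_(i < p) Q ^+ i.
have Qp : Q ^+ p = 1 by rewrite /Q exprZn Pp wp scale1r.
have QS : Q * S = S.
  by apply/eqP; rewrite -subr_eq0 -{2}[S]mul1r -mulrBl -subrX1 Qp subrr.
have QiS i : Q ^+ i * S = S by elim: i => [|i IHi]; rewrite ?mul1r // exprSr -mulrA QS.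
have SS : S * S = p%:R *: S.
  rewrite {1}/S mulr_suml (eq_bigr (fun=> S)) // sumr_const card_ord.
  by rewrite scaler_nat.
have QE : GRing.comm E Q by rewrite /GRing.comm -scalerAl -scalerAr PE.
have SE : E * S = S * E.
  by apply: commr_sum => i _; apply: commrX.
pose F := p%:R^-1 *: S * E.
have idF : F *m F = F.
  rewrite -[LHS]/(F * F) /F -!scalerAl -!scalerAr -mulrA (mulrA E) SE -!mulrA idE.
  by rewrite mulrA SS -!scalerAl !scalerA -mulrA mulVf // mulr1.
exists (\rank F); rewrite natrM -(mxtrace_idem idF) /F -scalerAl mxtraceZ.
rewrite mulrA mulfV // mul1r mulr_suml raddf_sum /=.
by apply: eq_bigr => i _; rewrite /Q exprZn -scalerAl mxtraceZ.
Qed.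

(** By [average_trace_nat] the traces of [P ^+ k * E] are the Fourier transform
of the multiplicities [m j] of the eigenvalues [z ^+ j] of [P] on the image of
[E]. A field automorphism that sends [z] to [z ^+ i] carries the trace of
[P * E] to that of [P ^+ i * E], and fixes it when it is rational. *)
Lemma mxtrace_prime_order p n (P E : 'M[algC]_n.+1) :
    prime p -> P ^+ p = 1 -> P * E = E * P -> E * E = E ->
    \tr (P * E) \in Crat ->
  exists n0 n1 : nat, \tr E = (n0 + p.-1 * n1)%:R /\
    forall i, ~~ (p %| i)%N -> \tr (P ^+ i * E) = n0%:R - n1%:R.
Proof.
move=> p_pr Pp PE idE Qtr; have p_gt0 := prime_gt0 p_pr.
have pnz : p%:R != 0 :> algC by rewrite pnatr_eq0 -lt0n.
have [z prim_z] := C_prim_root_exists p_gt0.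
have z_neq0 : z != 0 by rewrite (prim_root_eq0 prim_z) -lt0n.
have zp : z ^+ p = 1 := prim_expr_order prim_z.
pose c i := \tr (P ^+ i * E).
have [m mE] : exists m : 'I_p -> nat,
    forall j : 'I_p, \sum_(i < p) (z ^- j) ^+ i * c i = (p * m j)%:R.
  apply: (fin_all_exists (P := fun (j : 'I_p) m => _ = (p * m)%:R)) => j.
  apply: average_trace_nat => //.
  by rewrite exprVn -exprM mulnC exprM zp expr1n invr1.
(* Fourier inversion: for i != k the sum of the powers of z ^+ k / z ^+ i is 0 *)
have cE k : (k < p)%N -> c k = \sum_(j < p) (z ^+ k) ^+ j * (m j)%:R.
  move=> k_lt; apply: (mulfI pnz); rewrite [RHS]mulr_sumr.
  under [RHS]eq_bigr => j _.
    rewrite mulrCA -natrM -mE mulr_sumr.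
    under eq_bigr => i _ do rewrite mulrA.
    over.
  rewrite [RHS]exchange_big /= (bigD1 (Ordinal k_lt)) //= [X in _ + X]big1 ?addr0.
    rewrite -mulr_suml; congr (_ * _).
    transitivity (\sum_(j < p) (1 : algC)); first by rewrite sumr_const card_ord.
    apply: eq_bigr => j _.
    rewrite -exprM exprVn -exprM mulnC mulfV // expf_neq0 //.
  move=> i nik; rewrite -mulr_suml.
  pose y := z ^+ k / z ^+ i.
  have yp : y ^+ p = 1.
    by rewrite exprMn exprVn -!exprM ![(_ * p)%N]mulnC !exprM zp !expr1n divr1.
  have y1 : y - 1 != 0.
    rewrite subr_eq0; apply: contra nik => /eqP/(canRL (mulfVK _)).
    rewrite mul1r => /(_ (expf_neq0 _ z_neq0))/eqP.
    by rewrite (eq_prim_root_expr prim_z) !modn_small // eq_sym.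
  suff -> : \sum_(j < p) (z ^+ k) ^+ j * (z ^- j) ^+ i = 0 by rewrite mul0r.
  apply: (mulfI y1); rewrite mulr0; transitivity (y ^+ p - 1); last by rewrite yp subrr.
  rewrite subrX1; congr (_ * _).
  by apply: eq_bigr => j _; rewrite exprMn !exprVn -!exprM (mulnC j).
have c_const i : ~~ (p %| i)%N -> c i = c 1%N.
  move=> pi.
  have Pmod k : P ^+ (k %% p)%N = P ^+ k.
    by rewrite {2}(divn_eq k p) exprD mulnC exprM Pp expr1n mul1r.
  have <- : c (i %% p)%N = c i by rewrite /c Pmod.
  have co : coprime (i %% p)%N p by rewrite coprime_modl coprime_sym prime_coprime.
  have [u uE] := Qn_aut_exists co.
  rewrite cE ?ltn_mod //.
  rewrite -[RHS](aut_Crat u) // cE ?prime_gt1 // raddf_sum /=.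
  apply: eq_bigr => j _; rewrite rmorphM rmorph_nat; congr (_ * _).
  by rewrite uE ?expr1 -?exprM // mulnC // exprM zp expr1n.
have split0 (f : nat -> algC) :
    \sum_(i < p) f i = f 0 + \sum_(i < p.-1) f i.+1.
  by case: (p) p_gt0 => // q _; rewrite big_ord_recl.
have cS w : \sum_(i < p) w ^+ i * c i = c 0 + (\sum_(i < p) w ^+ i - 1) * c 1%N.
  rewrite (split0 (fun i => w ^+ i * c i)) (split0 (fun i => w ^+ i)).
  rewrite !expr0 mul1r addrAC addrN add0r mulr_suml.
  congr (_ + _); apply: eq_bigr => i _; rewrite c_const // gtnNdvd //.
  by rewrite -ltn_predRL.
have z_neq1 : z - 1 != 0.
  rewrite subr_eq0 -[z]expr1 -[1 in X in _ != X](expr0 z) (eq_prim_root_expr prim_z).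
  by rewrite modn_small ?prime_gt1 // mod0n.
have sum_z : \sum_(i < p) z ^+ i = 0.
  by apply: (mulfI z_neq1); rewrite -subrX1 zp subrr mulr0.
(* n0 and n1 are the multiplicities of the eigenvalues 1 and z *)
have [n0 n0E] := average_trace_nat p_gt0 Pp PE idE (expr1n _ _).
have [n1 n1E] := average_trace_nat p_gt0 Pp PE idE zp.
rewrite cS (eq_bigr (fun=> 1)) in n0E; last by move=> i _; rewrite expr1n.
rewrite sumr_const card_ord in n0E.
rewrite cS sum_z sub0r mulN1r in n1E.
have c1E : c 1%N = n0%:R - n1%:R.
  apply: (mulfI pnz); rewrite mulrBr -!natrM -n0E -n1E; ring.
exists n0, n1; split; last by move=> i pi; rewrite -c1E -/(c i) c_const.
transitivity (c 0); first by rewrite /c mul1r.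
move/eqP: n1E; rewrite subr_eq => /eqP ->; rewrite c1E.
rewrite -{1}(prednK p_gt0); set q := p.-1; rewrite !natrD !natrM; ring.
Qed.

(** * Automorphisms on an eigenspace of the adjacency matrix *)

Section IndexedMatrices.

Variables (T : finType) (n : nat) (e : 'I_n.+1 -> T).
Hypothesis bij_e : bijective e.

(** Rows and columns are indexed through [e] by a type ['I_n.+1], since ['M_n.+1]
is an algebra. *)
Definition mx_of (f : T -> T -> algC) : 'M[algC]_n.+1 :=
  \matrix_(i, j) f (e i) (e j).

Definition pmx (g : {perm T}) := mx_of (fun u w => (g u == w)%:R).

Lemma eq_mx_of f g : f =2 g -> mx_of f = mx_of g.
Proof. by move=> fg; apply/matrixP=> i j; rewrite !mxE fg. Qed.

Lemma mx_ofM f g :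
  mx_of f * mx_of g = mx_of (fun u w => \sum_t f u t * g t w).
Proof.
apply/matrixP=> i j; rewrite !mxE [RHS](reindex e) /=; last exact: onW_bij.
by apply: eq_bigr => k _; rewrite !mxE.
Qed.

Lemma tr_mx_of f : \tr (mx_of f) = \sum_u f u u.
Proof.
rewrite [RHS](reindex e) /=; last exact: onW_bij.
by apply: eq_bigr => k _; rewrite mxE.
Qed.

Lemma pmx_mulE g f : pmx g * mx_of f = mx_of (fun u w => f (g u) w).
Proof.
rewrite mx_ofM; apply: eq_mx_of => u w.
rewrite (bigD1 (g u)) //= eqxx mul1r big1 ?addr0 // => t.
by rewrite eq_sym => /negPf->; rewrite mul0r.
Qed.

Lemma mul_pmxE g f : mx_of f * pmx g = mx_of (fun u w => f u ((g^-1)%g w)).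
Proof.
rewrite mx_ofM; apply: eq_mx_of => u w.
rewrite (bigD1 ((g^-1)%g w)) //= permKV eqxx mulr1 big1 ?addr0 // => t.
by rewrite -(inj_eq (@perm_inj _ g)) permKV => /negPf->; rewrite mulr0.
Qed.

Lemma mx_of1 : mx_of (fun u w => (u == w)%:R) = 1.
Proof.
by apply/matrixP=> i j; rewrite !mxE (inj_eq (bij_inj bij_e)).
Qed.

Lemma pmx1 : pmx 1%g = 1.
Proof. by rewrite -mx_of1; apply: eq_mx_of => u w; rewrite perm1. Qed.

Lemma pmxM g h : pmx (g * h)%g = pmx g * pmx h.
Proof. by rewrite pmx_mulE; apply: eq_mx_of => u w; rewrite permM. Qed.

Lemma pmxX g i : pmx (g ^+ i)%g = pmx g ^+ i.
Proof.
elim: i => [|i IHi]; first by rewrite expg0 pmx1.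
by rewrite expgS exprS pmxM IHi.
Qed.

End IndexedMatrices.

Section EigenspaceTrace.

Variable G : sgraph.
Hypothesis srgG : strongly_regular G 352 26 0 2.
Variable e : 'I_352 -> G.
Hypothesis bij_e : bijective e.

Let cardG : #|G| = 352%N. Proof. by case: srgG. Qed.

Let A := mx_of e (fun u w : G => (adj u w)%:R).
Let J := mx_of e (fun _ _ => 1).

Let sum_adj (u : G) : \sum_t (adj u t)%:R = 26 :> algC.
Proof.
have [_ deg _ _] := srgG; rewrite -(deg u) -sum1_card natr_sum.
by rewrite [RHS]big_mkcond; apply: eq_bigr => t _; rewrite inE; case: adj.
Qed.

Let mulAJ : A * J = 26 *: J.
Proof.
rewrite mx_ofM //; apply/matrixP => i j; rewrite !mxE -(sum_adj (e i)) mulr1.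
by apply: eq_bigr => t _; rewrite mulr1.
Qed.

Let mulJA : J * A = 26 *: J.
Proof.
rewrite mx_ofM //; apply/matrixP => i j; rewrite !mxE -(sum_adj (e j)) mulr1.
by apply: eq_bigr => t _; rewrite mul1r adj_sym.
Qed.

Let mulJJ : J * J = 352 *: J.
Proof.
rewrite mx_ofM //; apply/matrixP => i j; rewrite !mxE.
by rewrite sumr_const cardG !mulr1.
Qed.

Let mulAA : A * A = 24 *: 1 - 2 *: A + 2 *: J.
Proof.
have [_ deg nadj nonadj] := srgG.
rewrite -(mx_of1 bij_e) mx_ofM //; apply/matrixP => i j; rewrite !mxE.
set u := e i; set w := e j.
have -> : \sum_t (adj u t)%:R * (adj t w)%:R
    = #|neighbours u :&: neighbours w|%:R :> algC.
  rewrite -sum1_card natr_sum [RHS]big_mkcond; apply: eq_bigr => t _.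
  by rewrite !inE (adj_sym t); do 2!case: adj; rewrite ?mul0r ?mulr0 ?mulr1.
have [->|nuw] := eqVneq u w; first by rewrite setIid deg adj_irrefl /=; ring.
have [uw|nuw_adj] := boolP (adj u w); first by rewrite nadj //=; ring.
by rewrite nonadj //=; ring.
Qed.

(** The idempotent of the eigenvalue -6: the polynomial [(4 - X) / 10] in [A] is
1 at -6 and 0 at 4, and the multiple of [J] makes its value 0 at
the eigenvalue 26 of the all-ones vector. *)
Definition eigenproj : 'M[algC]_352 :=
  10^-1 *: (4 *: 1 - A + 16^-1 *: J).

Lemma eigenproj_idem : eigenproj * eigenproj = eigenproj.
Proof.
rewrite /eigenproj -!scalerAl -!scalerAr; congr (_ *: _).
rewrite !(mulrDl, mulrDr, mulrN, mulNr) -!scalerAl -!scalerAr.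
rewrite !mul1r !mulr1 mulAA mulAJ mulJA mulJJ.
by apply/matrixP => i j; rewrite !mxE; field.
Qed.

Let tr_pmx_eigenproj g :
  \tr (pmx e g * eigenproj) =
    (4 * #|('Fix_'P[g])%g|%:R - (a1 g)%:R + 22) / 10.
Proof.
rewrite /eigenproj -scalerAr mxtraceZ [LHS]mulrC; congr (_ / _).
rewrite !(mulrDl, mulrDr, mulrN) -!scalerAr mulr1 !raddfD raddfN /= !mxtraceZ.
rewrite !pmx_mulE // !tr_mx_of //.
have -> : \sum_u (g u == u)%:R = #|('Fix_'P[g])%g|%:R :> algC.
  rewrite -sum1_card natr_sum [RHS]big_mkcond; apply: eq_bigr => u _.
  by rewrite (sameP afix1P eqP) /= apermE; case: eqP.
have -> : \sum_u (adj (g u) u)%:R = (a1 g)%:R :> algC.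
  rewrite /a1 -sum1_card natr_sum [RHS]big_mkcond; apply: eq_bigr => u _.
  by rewrite inE adj_sym; case: adj.
by rewrite sumr_const cardG; field.
Qed.

(** The trace of [x ^+ i] on the eigenspace is [n0 - n1], where [n0] and [n1] are
the multiplicities of 1 and of a primitive root; subtraction-free form. *)
Lemma srg_prime_aut_trace p x : x \in graph_aut G -> prime p -> #[x]%g = p ->
  exists n0 n1 : nat, n0 + p.-1 * n1 = 143%N /\
    forall i, ~~ (p %| i)%N ->
      (4 * #|('Fix_'P[x ^+ i])%g| + 22 + 10 * n1 = a1 (x ^+ i)%g + 10 * n0)%N.
Proof.
move=> x_aut p_pr ox.
have Pp : pmx e x ^+ p = 1.
  by rewrite -pmxX // -ox expg_order pmx1.
have PE : pmx e x * eigenproj = eigenproj * pmx e x.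
  rewrite /eigenproj -scalerAl -scalerAr; congr (_ *: _).
  rewrite !(mulrDl, mulrDr, mulrN, mulNr) -!scalerAl -!scalerAr mul1r mulr1.
  rewrite !pmx_mulE // !mul_pmxE //.
  suff -> : mx_of e (fun u w : G => (adj (x u) w)%:R)
      = mx_of e (fun u w => (adj u ((x^-1)%g w))%:R) by [].
  apply: eq_mx_of => u w; move: x_aut; rewrite inE => /forallP/(_ u)/forallP.
  by move/(_ ((x^-1)%g w))/eqP <-; rewrite permKV.
have [|n0 [n1 [trE trPE]]] := mxtrace_prime_order p_pr Pp PE eigenproj_idem.
  rewrite tr_pmx_eigenproj; apply: rpred_div; last exact: rpred_nat.
  by rewrite rpredD ?rpredB ?rpredM ?rpred_nat.
exists n0, n1; split.
  apply/eqP; rewrite -(eqr_nat algC) -trE.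
  have := tr_pmx_eigenproj 1; rewrite pmx1 // mul1r => ->.
  have -> : ('Fix_'P[1])%g = setT :> {set G}.
    by apply/setP=> u; rewrite [RHS]inE; apply/afix1P; rewrite act1.
  have -> : a1 (1%g : {perm G}) = 0%N.
    by apply/eqP; rewrite cards_eq0; apply/set0Pn => -[u]; rewrite inE perm1 adj_irrefl.
  by rewrite cardsT cardG; apply/eqP; field.
move=> i /trPE; rewrite -pmxX // tr_pmx_eigenproj => tri.
set a0 := #|_|; set b1 := a1 _; rewrite -/a0 -/b1 in tri.
suff : 4 * a0%:R + 22 + 10 * n1%:R = b1%:R + 10 * n0%:R :> algC.
  by rewrite -!natrM -!natrD => /eqP; rewrite eqr_nat => /eqP.
have -> : n0%:R = n1%:R + (4 * a0%:R - b1%:R + 22) / 10 :> algC.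
  by rewrite tri; ring.
by field.
Qed.

End EigenspaceTrace.

End Traces.

Local Open Scope group_scope.

(** * Vertices fixed by an automorphism of prime order *)

Section FixedVertices.

Variables (G : sgraph) (v k : nat).
Hypothesis srgG : strongly_regular G v k 0 2.
Variables (x : {perm G}) (p : nat).
Hypotheses (x_aut : x \in graph_aut G) (p_pr : prime p) (p_gt2 : 2 < p).
Hypothesis x_order : #[x] = p.
(* F is the set of fixed vertices, kept abstract so that rewriting with inE
   stops at membership in F. *)
Variable F : {set G}.
Hypothesis fixE : forall u, (u \in F) = (x u == u).

Local Notation N := (@neighbours G).

Lemma adj_aut u w : adj (x u) (x w) = adj u w.
Proof. by move: x_aut; rewrite inE => /forallP/(_ u)/forallP/(_ w)/eqP. Qed.

Lemma card_fix_mod (S : {set G}) :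
  {in S, forall u, x u \in S} -> #|S| = #|S :&: F| %[mod p].
Proof.
have -> : F = 'Fix_'P[x] by apply/setP=> u; rewrite fixE (sameP afix1P eqP).
move=> xS; rewrite -afix_cycle; apply: pgroup_fix_mod.
  by rewrite /pgroup -orderE x_order pnat_id.
rewrite cycle_subG !inE /=; apply/subsetP => u uS.
by rewrite inE /= apermE xS.
Qed.

Lemma no_triangle (u w t : G) : adj u w -> adj u t -> adj w t -> False.
Proof.
have [_ _ nadj _] := srgG => uw ut wt.
have /eqP := nadj _ _ uw; rewrite cards_eq0 => /set0Pn[].
by exists t; rewrite !inE ut.
Qed.

Lemma card_common (u w : G) : u != w -> ~~ adj u w -> #|N u :&: N w| = 2.
Proof. by case: srgG => _ _ _; apply. Qed.

(** [x] permutes the two common neighbours, and its order is an odd prime. *)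
Lemma common_fixed (u w : G) :
  u \in F -> w \in F -> u != w -> ~~ adj u w -> N u :&: N w \subset F.
Proof.
rewrite !fixE => /eqP xu /eqP xw nuw nadj; have card2 := card_common nuw nadj.
have /card_fix_mod : {in N u :&: N w, forall t, x t \in N u :&: N w}.
  by move=> t; rewrite !inE -{2}xu -{2}xw !adj_aut.
have leF : #|N u :&: N w :&: F| <= 2 by rewrite -card2 subset_leq_card ?subsetIl.
rewrite card2 !modn_small // ?(leq_ltn_trans leF) // => eq2.
by apply/setIidPl/eqP; rewrite eqEcard subsetIl card2 -eq2.
Qed.

(** If [a] and [b] were distinct, they would be nonadjacent because there are no
triangles, and [common_fixed] would apply to their common neighbour [w]. *)
Lemma fixed_neighbour_unique (w a b : G) :
  w \notin F -> a \in F -> b \in F -> adj a w -> adj b w -> a = b.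
Proof.
move=> wF aF bF aw bw; apply/eqP/negPn; apply: contra wF => nab.
have nadj : ~~ adj a b.
  by apply/negP => ab; apply: (no_triangle ab aw bw).
by apply: (subsetP (common_fixed aF bF nab nadj)); rewrite !inE aw.
Qed.

Definition fixed_degree (u : G) := #|N u :&: F|.

Lemma fixed_degree_mod u : u \in F -> fixed_degree u = k %[mod p].
Proof.
rewrite fixE => /eqP xu; have [_ deg _ _] := srgG.
rewrite -(deg u) -card_fix_mod // => w; rewrite !inE.
by rewrite -{2}xu adj_aut.
Qed.

(** If all neighbours of [u] are fixed, then every vertex not adjacent to [u] has
two fixed neighbours in common with [u], so it is fixed too, and [x = 1]. *)
Lemma fixed_degree_ltn u : u \in F -> fixed_degree u < k.
Proof.
move=> uF; have [_ deg _ _] := srgG.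
rewrite -(deg u) /fixed_degree ltn_neqAle subset_leq_card ?subsetIl // andbT.
apply/negP => /eqP eqN.
have NF : N u \subset F.
  by apply/setIidPl/eqP; rewrite eqEcard subsetIl eqN /=.
have allF w : w \in F.
  apply/negPn/negP => wF.
  have nuw : u != w by apply: contraNneq wF => <-.
  have nadj : ~~ adj u w.
    by apply: contra wF => uw; apply: (subsetP NF); rewrite inE.
  have /eqP/cards2P[a [b [nab defI]]] := card_common nuw nadj.
  have [aI bI] : a \in N u :&: N w /\ b \in N u :&: N w.
    by rewrite defI !inE !eqxx orbT.
  move: aI bI; rewrite !inE => /andP[ua wa] /andP[ub wb].
  case/eqP: nab; apply: (fixed_neighbour_unique wF).
  - by apply: (subsetP NF); rewrite inE.
  - by apply: (subsetP NF); rewrite inE.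
  - by rewrite adj_sym.
  - by rewrite adj_sym.
have x1 : x = 1.
  by apply/permP => w; rewrite perm1; apply/eqP; rewrite -fixE.
by move: p_gt2; rewrite -x_order x1 order1.
Qed.

(** The sets of moved neighbours of the fixed vertices are pairwise disjoint. *)
Lemma fixed_count m : {in F, forall u, m <= k - fixed_degree u} ->
  #|F| * m.+1 <= v.
Proof.
have [<- deg _ _] := srgG => le_m.
rewrite -(cardsC F) mulnS leq_add2l.
have cardD u : #|N u :\: F| = k - fixed_degree u.
  by rewrite -(deg u) -(cardsID F (N u)) addKn.
apply: (@leq_trans (\sum_(u in F) \sum_(w in ~: F) adj u w)).
  rewrite -sum_nat_const; apply: leq_sum => u uF.
  rewrite (leq_trans (le_m u uF)) // -cardD -sum1_card.
  rewrite big_mkcond [X in _ <= X]big_mkcond; apply: leq_sum => w _.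
  by rewrite !inE; case: (w \in F) => //=; case: adj.
rewrite exchange_big /= -sum1_card; apply: leq_sum => w; rewrite inE => wF.
have [a /andP[aF aw]|none] := pickP [pred a | (a \in F) && adj a w].
  rewrite (bigD1 a) //= aw big1 // => b /andP[bF nba].
  apply/eqP; rewrite eqb0; apply: contra nba => bw.
  by rewrite (fixed_neighbour_unique wF aF bF aw bw) eqxx.
rewrite big1 // => a aF; apply/eqP; rewrite eqb0.
by have /= := none a; rewrite aF /= => ->.
Qed.

(** Two adjacent fixed vertices have disjoint neighbourhoods, which gives
[2 * d] fixed vertices. *)
Lemma fixed_regular_bound d u : u \in F -> 0 < d ->
  {in F, forall w, fixed_degree w = d} -> d.*2 * (k - d).+1 <= v.
Proof.
move=> uF d_gt0 degF.
have /card_gt0P[w] : 0 < #|N u :&: F| by rewrite -/(fixed_degree u) degF.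
rewrite !inE => /andP[uw wF].
apply: leq_trans (fixed_count (m := k - d) _); last by move=> t /degF ->.
rewrite leq_mul2r -addnn; apply/orP; right.
rewrite -{1}(degF u uF) -(degF w wF) /fixed_degree -cardsUI.
have -> : N u :&: F :&: (N w :&: F) = set0.
  apply/setP=> t; rewrite !inE; apply/negP => /andP[/andP[ut _] /andP[wt _]].
  exact: no_triangle uw ut wt.
by rewrite cards0 addn0 subset_leq_card // subUset !subsetIr.
Qed.

(** Let [c] be a fixed vertex at distance 2 from [u]. Two of the four fixed
neighbours of [u] are adjacent to [c]; let [f] and [g] be the other two. A fixed
neighbour [d] of [c] that is not adjacent to [u] has two common neighbours with
[u], and these are not adjacent to [c], so they are [f] and [g]. There are at
least two such [d], and [u] is a third common neighbour of [f] and [g]. *)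
Lemma no_fixed_degree4 u : u \in F -> {in F, forall w, 4 <= fixed_degree w} ->
  fixed_degree u <> 4.
Proof.
move=> uF deg_ge degu.
have /card_gt0P[a] : 0 < #|N u :&: F| by rewrite -/(fixed_degree u) degu.
rewrite inE => /andP[]; rewrite inE => ua aF.
have /card_gt0P[c] : 0 < #|(N a :&: F) :\ u|.
  by have := deg_ge a aF; rewrite /fixed_degree (cardsD1 u); case: (u \in _) => //=; lia.
rewrite !inE => /and3P[ncu ac cF].
have nuc : ~~ adj u c by apply/negP => uc; apply: no_triangle ua uc ac.
have nuc' : u != c by rewrite eq_sym.
pose S := (N u :&: F) :\: N c.
have card_uc := card_common nuc' nuc.
have uc_F := common_fixed uF cF nuc' nuc.
have cardS : #|S| = 2.
  have := cardsID (N c) (N u :&: F); rewrite -/S -/(fixed_degree u) degu.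
  have -> : N u :&: F :&: N c = N u :&: N c by rewrite setIAC; apply/setIidPl.
  by rewrite card_uc; lia.
have adjS d : d \in (N c :&: F) :\: N u -> N u :&: N d = S.
  rewrite !inE => /and3P[nud cd dF].
  have nud' : u != d by apply: contraNneq nuc => ->; rewrite adj_sym.
  apply/eqP; rewrite eqEcard cardS card_common // andbT.
  apply/subsetP => t tI; have := subsetP (common_fixed uF dF nud' nud) t tI.
  move: tI; rewrite !inE => /andP[ut dt] tF; rewrite ut tF !andbT.
  by apply/negP => ct; apply: no_triangle cd ct dt.
have /eqP/cards2P[f [g [nfg defS]]] := cardS.
have /andP[fS gS] : (f \in S) && (g \in S) by rewrite defS !inE !eqxx orbT.
have [uf ug] : adj u f /\ adj u g.
  by move: fS gS; rewrite !inE => /andP[_ /andP[-> _]] /andP[_ /andP[-> _]].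
have nadj_fg : ~~ adj f g by apply/negP => fg; apply: no_triangle uf ug fg.
have : u |: (N c :&: F) :\: N u \subset N f :&: N g.
  apply/subsetP => t /setU1P[->|tD]; first by rewrite !inE !(adj_sym _ u) uf.
  by move: fS gS; rewrite -(adjS t tD) !inE !(adj_sym t) => /andP[_ ->] /andP[_ ->].
move/subset_leq_card; rewrite card_common // cardsU1.
have -> : u \notin (N c :&: F) :\: N u.
  by rewrite !inE (adj_sym c) (negPf nuc) !andbF.
rewrite add1n ltnS => cardD_le1.
have := deg_ge c cF; rewrite /fixed_degree -(cardsID (N u)).
have -> : N c :&: F :&: N u = N u :&: N c.
  by rewrite setIAC (setIC (N c)); apply/setIidPl.
by rewrite card_uc (leq_add2l 2 2) leqNgt ltnS cardD_le1.
Qed.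

Lemma fixXE i u : ~~ (p %| i) -> ((x ^+ i) u == u) = (u \in F).
Proof.
move=> pi; have co_pi : coprime #|<[x]>| i by rewrite -orderE x_order prime_coprime.
rewrite fixE; apply/eqP/eqP => [xiu|xu]; last by rewrite permX iter_fix.
rewrite -[x in LHS](expgK co_pi (cycle_id x)).
by rewrite permX; apply: iter_fix.
Qed.

(** * The circulant graphs on the orbits *)

Section Orbit.

Variable u : G.
Hypothesis uF : u \notin F.

Definition orbit_link i := adj u ((x ^+ i) u).

Lemma orbit_inj : {in [pred i | i < p] &, injective (fun i => (x ^+ i) u)}.
Proof.
move=> i j; rewrite !inE.
wlog le_ij : i j / i <= j => [IH|i_lt j_lt eq_ij].
  by case/orP: (leq_total i j) => le_ij ? ? e; [|symmetry]; apply: IH.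
apply/eqP; rewrite eqn_leq le_ij leqNgt /=; apply: contra uF => lt_ij.
rewrite -(fixXE (i := j - i)) ?gtnNdvd ?subn_gt0 //; last first.
  by rewrite (leq_ltn_trans (leq_subr _ _)).
by rewrite -(inj_eq (@perm_inj _ (x ^+ i))) -permM -expgD subnK ?eq_ij.
Qed.

Lemma adj_autX i a b : adj ((x ^+ i) a) ((x ^+ i) b) = adj a b.
Proof. by rewrite !permX; elim: i => //= i <-; rewrite adj_aut. Qed.

Lemma orbit_linkE i r : i < p ->
  orbit_link ((r + p - i) %% p) = adj ((x ^+ i) u) ((x ^+ r) u).
Proof.
move=> /ltnW i_le; rewrite /orbit_link -x_order expg_mod_order x_order.
rewrite -(adj_autX i) -permM -expgD subnK ?(leq_trans i_le) ?leq_addl //.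
have xp : x ^+ p = 1 by rewrite -x_order expg_order.
by rewrite expgD xp mulg1.
Qed.

(** [u] and [x ^+ r u] have no common neighbour if they are adjacent and two
otherwise; only the common neighbours inside the orbit are counted here. *)
Lemma orbit_common r : 0 < r < p ->
  count (fun i => orbit_link i && orbit_link ((r + p - i) %% p)) (iota 0 p)
    <= (~~ orbit_link r).*2.
Proof.
move=> /andP[r_gt0 r_lt].
have nur : u != (x ^+ r) u.
  by rewrite eq_sym fixXE // gtnNdvd.
have -> : (~~ orbit_link r).*2 = #|N u :&: N ((x ^+ r) u)|.
  have [ur|nur'] := boolP (orbit_link r); last by rewrite card_common.
  by have [_ _ /(_ _ _ ur)-> _] := srgG.
set P := fun i => _; pose s := [seq (x ^+ i) u | i <- iota 0 p & P i].
have sE i : i \in [seq i <- iota 0 p | P i] -> (i < p) && P i.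
  by rewrite mem_filter mem_iota andbC.
rewrite -size_filter -(size_map (fun i => (x ^+ i) u)) -/s.
have /card_uniqP <- : uniq s.
  rewrite map_inj_in_uniq ?filter_uniq ?iota_uniq // => i j.
  by move=> /sE/andP[i_lt _] /sE/andP[j_lt _]; apply: orbit_inj.
apply/subset_leq_card/subsetP => _ /mapP[i /sE/andP[i_lt /andP[ui iur]] ->].
rewrite !inE; apply/andP; split; first exact: ui.
by rewrite adj_sym -orbit_linkE.
Qed.

Lemma orbit_link_sym i : i < p -> orbit_link ((p - i) %% p) = orbit_link i.
Proof.
move=> i_lt; rewrite -[p - i](add0n) addnBA ?(ltnW i_lt) //.
by rewrite orbit_linkE // expg0 perm1 adj_sym.
Qed.

End Orbit.

End FixedVertices.

(** [s] lists the indicator of a symmetric connection set in the integers modulo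
11; the hypothesis bounds the number of common neighbours of 0 and [r]. The 32
such sets are checked by computation. *)
Lemma circulant11 (b1 b2 b3 b4 b5 : bool) :
  let s := [:: false; b1; b2; b3; b4; b5; b5; b4; b3; b2; b1] in
  let f := nth false s in
  all (fun r => count (fun i => f i && f ((r + 11 - i) %% 11)) (iota 0 11)
                  <= (~~ f r).*2) (iota 1 10) ->
  count f (iota 1 10) <= 2.
Proof. by case: b1 b2 b3 b4 b5 => [] [] [] [] []. Qed.

Section Orbit11.
Variables (G : sgraph) (v k : nat).
Hypothesis srgG : strongly_regular G v k 0 2.
Variable x : {perm G}.
Hypotheses (x_aut : x \in graph_aut G) (x_order : #[x] = 11).

Lemma orbit11_degree u : x u != u ->
  count (fun i => adj u ((x ^+ i) u)) (iota 1 10) <= 2.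
Proof.
move=> xu.
pose F := [set w | x w == w].
have fixE w : (w \in F) = (x w == w) by rewrite inE.
have uF : u \notin F by rewrite fixE.
pose f := orbit_link x u.
have f_sym i : i < 11 -> f ((11 - i) %% 11) = f i.
  by apply: (orbit_link_sym x_aut x_order).
pose s := [:: false; f 1%N; f 2; f 3; f 4; f 5; f 5; f 4; f 3; f 2; f 1%N].
have fE i : i < 11 -> f i = nth false s i.
  case: i => [_|]; first by rewrite /f /orbit_link expg0 perm1 adj_irrefl.
  do 5!(case; first by []).
  by do 5!(case; first by rewrite -f_sym).
have -> : count (fun i => adj u ((x ^+ i) u)) (iota 1 10)
    = count (nth false s) (iota 1 10).
  by apply: eq_in_count => i; rewrite mem_iota => /andP[_ i_lt]; rewrite -fE.
apply: circulant11; apply/allP => r; rewrite mem_iota => /andP[r_gt0 r_lt].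
rewrite -/s -fE //.
have := orbit_common srgG x_aut (isT : prime 11) x_order fixE uF (r := r).
rewrite r_gt0 r_lt => /(_ isT); congr (_ <= _); apply: eq_in_count => i.
by rewrite mem_iota => i_lt; rewrite -!fE ?ltn_mod.
Qed.

(** Count by vertices: [orbit11_degree] bounds the number of powers of
[x] that move a given vertex to a neighbour. *)
Lemma sum_a1_order11 : (forall u, x u != u) ->
  \sum_(1 <= i < 11) a1 (x ^+ i) <= v.*2.
Proof.
move=> nfix; have [<- _ _ _] := srgG.
rewrite -mul2n mulnC -sum_nat_const.
under eq_bigr => i _.
  rewrite /a1 -sum1_card big_mkcond.
  under eq_bigr => u _ do rewrite inE.
  over.
rewrite exchange_big /=; apply: leq_sum => u _.
by rewrite -big_mkcond sum1_count orbit11_degree.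
Qed.

End Orbit11.

(** * Fixed vertices for the orders 13 and 11 *)

Lemma srg_fix_order13 (G : sgraph) (x : {perm G}) :
  strongly_regular G 352 26 0 2 -> x \in graph_aut G -> #[x] = 13 ->
  #|'Fix_'P[x]| = 1%N.
Proof.
move=> srgG x_aut ox; have [cardG _ _ _] := srgG.
set F := 'Fix_'P[x] : {set G}.
have fixE w : (w \in F) = (x w == w) by rewrite (sameP afix1P eqP).
have p_pr : prime 13 by [].
have F_mod : #|F| = 1%N %[mod 13].
  have /= := card_fix_mod p_pr ox fixE (S := setT) (fun u _ => in_setT _).
  by rewrite setTI cardsT cardG => <-.
have [F_le1|F_gt1] := leqP #|F| 1.
  by move: F_le1 F_mod; case: #|F| => [|[]].
have degF : {in F, forall u, fixed_degree F u = 13}.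
  move=> u uF.
  have := fixed_degree_mod srgG x_aut p_pr ox fixE uF.
  have := fixed_degree_ltn srgG x_aut p_pr isT ox fixE uF.
  suff : 0 < fixed_degree F u by move: (fixed_degree F u) => d; lia.
  have /card_gt0P[w] : 0 < #|F :\ u| by move: F_gt1; rewrite (cardsD1 u) uF.
  rewrite !in_setD1 => /andP[nwu wF].
  have [uw|nuw] := boolP (adj u w).
    by apply/card_gt0P; exists w; rewrite in_setI wF !inE uw.
  rewrite eq_sym in nwu.
  apply: (@leq_trans #|neighbours u :&: neighbours w|).
    by rewrite (card_common srgG).
  by rewrite subset_leq_card // subsetI subsetIl (common_fixed srgG x_aut p_pr isT ox fixE).
have /card_gt0P[u uF] : 0 < #|F| by apply: ltnW.
by have := fixed_regular_bound srgG x_aut p_pr isT ox fixE uF (isT : 0 < 13) degF.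
Qed.

Lemma srg_fix_order11 (G : sgraph) (x : {perm G}) :
  strongly_regular G 352 26 0 2 -> x \in graph_aut G -> #[x] = 11 ->
  'Fix_'P[x] = set0 :> {set G}.
Proof.
move=> srgG x_aut ox.
set F := 'Fix_'P[x] : {set G}.
have fixE w : (w \in F) = (x w == w) by rewrite (sameP afix1P eqP).
have p_pr : prime 11 by [].
apply/eqP; rewrite -[_ == _]negbK; apply/set0Pn => -[u uF].
have degF w : w \in F -> fixed_degree F w = 4 \/ fixed_degree F w = 15.
  move=> wF; have := fixed_degree_mod srgG x_aut p_pr ox fixE wF.
  have := fixed_degree_ltn srgG x_aut p_pr isT ox fixE wF.
  by move: (fixed_degree F w) => d; lia.
have ge4 : {in F, forall w, 4 <= fixed_degree F w} by move=> w /degF[] ->.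
have deg15 : {in F, forall w, fixed_degree F w = 15}.
  move=> w wF; case: (degF w wF) => //.
  by case/(no_fixed_degree4 srgG x_aut p_pr isT ox fixE wF ge4).
by have := fixed_regular_bound srgG x_aut p_pr isT ox fixE uF (isT : 0 < 15) deg15.
Qed.

Lemma induced_card1_iso (G : sgraph) (A : {set G}) :
  #|A| = 1%N -> graph_iso (induced A) (complete_graph 1).
Proof.
move=> /eqP/cards1P[a defA]; have aA : a \in A by rewrite defA set11.
have allE (u : induced A) : u = Sub a aA.
  by apply: val_inj; apply/set1P; rewrite -defA; apply: valP.
exists (fun _ => ord0).
  by exists (fun _ => Sub a aA) => [u|i]; rewrite ?[RHS]allE ?[RHS]ord1.
by move=> u w; rewrite (allE u) (allE w) !adj_irrefl.
Qed.

(** * The proposition *)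

Theorem proposition8p4 (Delta : sgraph)
    (srg_Delta : strongly_regular Delta 352 26 0 2)
    (x : {perm Delta}) (x_aut : x \in graph_aut Delta)
    (p : nat) (p_prime : prime p) (x_order : #[x] = p)
    (p_val : p = 11 \/ p = 13) :
  (p = 13 -> graph_iso (fixed_graph x) (complete_graph 1) /\ a1 x = 26) /\
  (p = 11 -> 'Fix_'P[x] = set0 :> {set Delta} /\
             (forall i : nat, 1 <= i <= 10 -> a1 (x ^+ i) = 22)).
Proof.
have [cardG _ _ _] := srg_Delta.
have bij_e : bijective (fun i : 'I_352 => enum_val (cast_ord (esym cardG) i)).
  apply: bij_comp; first exact: enum_val_bij.
  by exists (cast_ord cardG) => i; rewrite (cast_ordK, cast_ordKV).
have [n0 [n1 [n01 trE]]] := srg_prime_aut_trace srg_Delta bij_e x_aut p_prime x_order.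
split=> p_eq; rewrite p_eq /= in n01 x_order trE *.
  have Fix1 := srg_fix_order13 srg_Delta x_aut x_order.
  split; last first.
    (* a1 x = 130 * n1 - 1404 and 12 * n1 <= 143 force n1 = 11 *)
    by have := trE 1%N isT; rewrite expg1 Fix1; lia.
  exact: induced_card1_iso.
have Fix0 := srg_fix_order11 srg_Delta x_aut x_order.
split=> //.
have fixE u : (u \in 'Fix_'P[x]) = (x u == u) by rewrite (sameP afix1P eqP).
have nfix u : x u != u by rewrite -fixE Fix0 inE.
have a1E i : 0 < i < 11 -> 22 + 10 * n1 = a1 (x ^+ i) + 10 * n0.
  move=> /andP[i_gt0 i_lt]; have pi : ~~ (11 %| i) by rewrite gtnNdvd.
  rewrite -(trE i pi); suff -> : 'Fix_'P[x ^+ i] = set0 :> {set Delta} by rewrite cards0.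
  apply/setP=> u; rewrite [RHS]inE (sameP afix1P eqP) /= apermE.
  by rewrite (fixXE (isT : prime 11) x_order fixE) // Fix0 inE.
have := sum_a1_order11 srg_Delta x_aut x_order nfix.
rewrite (eq_big_nat _ _ (F2 := fun=> 22 + 10 * n1 - 10 * n0)); last first.
  by move=> i /a1E ->; rewrite addnK.
(* a1 (x ^+ i) = 110 * n1 - 1408 and 10 * n1 <= 143 leave n1 = 13, giving 22,
   and n1 = 14, which violates the bound on the sum *)
rewrite sum_nat_const_nat => sum_le i /a1E.
by lia.
Qed.
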